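(* Let $n\ge 2$ be an integer and let $S_n$ be the symmetric group of all bijections of $\{1,\dots,n\}$ onto itself, with generating family the set $\mathcal{T}_n$ of all transpositions. Then the Cayley graph of $S_n$ related to $\mathcal{T}_n$ satisfies $CD(0,n(n-1))$.
   Context: The Cayley graph of a group $G$ related to a finite symmetric generating set $S$ (not containing the identity) has vertex set $G$, with $x\sim y$ if and only if $y=xs$ for some $s\in S$. In this setting the Laplacian is $\Delta f(x)=\sum_{y\sim x}(f(y)-f(x))$ for $f:G\to\mathbb{R}$ (no normalizing constant). Set $\Gamma(f,g)=\frac12(\Delta(fg)-f\Delta g-g\Delta f)$, $\Gamma f=\Gamma(f,f)$, $\Gamma_2 f=\frac12\Delta(\Gamma f)-\Gamma(f,\Delta f)$. The graph satisfies $CD(0,m)$ if $\Gamma_2 f\ge\frac1m(\Delta f)^2$ pointwise for all functions $f:G\to\mathbb{R}$. *)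

(* Defs.v *)
From HB Require Import structures.
From mathcomp Require Import all_boot all_order all_algebra all_fingroup.
From mathcomp Require Import reals.

Set Implicit Arguments.
Unset Strict Implicit.
Unset Printing Implicit Defensive.

Import Order.TTheory GRing.Theory Num.Theory.
Local Open Scope ring_scope.

Record cayley_genset (gT : finGroupType) := CayleyGenset {
  genset :> {set gT};
  genset_generates : (<<genset>> = [set: gT])%g;
  genset_sym : {in genset, forall s, (s^-1)%g \in genset};
  genset_not1 : (1%g : gT) \notin genset
}.

Definition cayley_adj (gT : finGroupType) (S : cayley_genset gT) : rel gT :=
  fun x y => [exists s in genset S, y == (x * s)%g].

Definition laplacian (R : realType) (T : finType) (e : rel T) (f : T -> R)
    : T -> R :=
  fun x => \sum_(y | e x y) (f y - f x).

Definition gamma (R : realType) (T : finType) (e : rel T) (f g : T -> R)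
    : T -> R :=
  fun x => 2^-1 * (laplacian e (fun y => f y * g y) x
                   - f x * laplacian e g x - g x * laplacian e f x).

Definition gamma2 (R : realType) (T : finType) (e : rel T) (f : T -> R)
    : T -> R :=
  fun x => 2^-1 * laplacian e (gamma e f f) x - gamma e f (laplacian e f) x.

Definition CD0 (R : realType) (T : finType) (e : rel T) (m : R) : Prop :=
  forall (f : T -> R) (x : T), m^-1 * laplacian e f x ^+ 2 <= gamma2 e f x.

(* The product of 'S_n is (s * t) i = t (s i), the opposite of composition; as
   this set is stable under conjugation, both conventions give the same Cayley
   graph. *)
Definition transpositions (n : nat) : {set 'S_n} :=
  [set tperm p.1 p.2 | p in [set p : 'I_n * 'I_n | p.1 != p.2]].

Lemma transpositionsP (n : nat) (s : 'S_n) :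
  reflect (exists i j : 'I_n, i != j /\ s = tperm i j)
          (s \in transpositions n).
Proof.
apply: (iffP imsetP) => [[[i j]]|[i [j [ij ->]]]].
  by rewrite inE => ij ->; exists i, j.
by exists (i, j); rewrite ?inE.
Qed.

Lemma transpositions_generate (n : nat) :
  (<<transpositions n>> = [set: 'S_n])%g.
Proof.
apply/eqP; rewrite eqEsubset subsetT /=.
apply/subsetP => s _; case: (prod_tpermP s) => ts -> dts.
rewrite big_seq; apply: group_prod => t /(allP dts) dt.
by apply: mem_gen; apply/transpositionsP; exists t.1, t.2.
Qed.

Lemma transpositions_sym (n : nat) :
  {in transpositions n, forall s, (s^-1)%g \in transpositions n}.
Proof.
move=> s /transpositionsP [i [j [ij ->]]]; rewrite tpermV.
by apply/transpositionsP; exists i, j.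
Qed.

Lemma transpositions_not1 (n : nat) : (1%g : 'S_n) \notin transpositions n.
Proof.
apply/transpositionsP => -[i [j [ij /permP/(_ i)]]].
by rewrite perm1 tpermL => eij; rewrite eij eqxx in ij.
Qed.

Definition transposition_genset (n : nat) : cayley_genset 'S_n :=
  CayleyGenset (transpositions_generate n) (@transpositions_sym n)
               (transpositions_not1 n).

(* Main.v *)
Require Import Defs.
From mathcomp Require Import all_boot all_order all_algebra all_fingroup.
From mathcomp Require Import reals.
From mathcomp Require Import ring lra.

(** Transpositions are stable under conjugation, so the two factors of a
    product of generators may be exchanged at the cost of renaming one of them.
    This turns [gamma2] into a sum of squares of mixed second differences, one
    for each pair of generators (lemma [gamma2_cayley]):
      4 Gamma_2 f(x) = \sum_(s, t) (f(xst) - f(xs) - f(xt) + f(x))^2.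
    As transpositions are involutions, the diagonal term [s = t] equals
    4 (f(xs) - f(x))^2, so that Gamma_2 f(x) is at least the sum of the
    (f(xs) - f(x))^2.  By Cauchy-Schwarz this is at least (Delta f(x))^2 / m for
    every [m] not smaller than the number of generators
    ([CD0_involution_class]), and there are at most n(n-1) transpositions, since
    each of them comes from an ordered pair of distinct points. *)

Set Implicit Arguments.
Unset Strict Implicit.
Unset Printing Implicit Defensive.

Import Order.TTheory GRing.Theory Num.Theory.
Local Open Scope ring_scope.

Lemma gammaE (R : realType) (T : finType) (e : rel T) (f g : T -> R) (x : T) :
  gamma e f g x = 2^-1 * \sum_(y | e x y) (f y - f x) * (g y - g x).
Proof.
rewrite /gamma /laplacian !mulr_sumr -!sumrB mulr_sumr.
by apply: eq_bigr => y _; ring.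
Qed.

(** Cauchy-Schwarz against the constant function: the inequality says that the
    deviations of [g] from (\sum_i g i) / m have a nonnegative sum of squares. *)
Lemma sqr_sum_le (R : realFieldType) (I : finType) (A : {set I}) (g : I -> R)
    (m : R) :
  0 < m -> #|A|%:R <= m ->
  m^-1 * (\sum_(i in A) g i) ^+ 2 <= \sum_(i in A) g i ^+ 2.
Proof.
move=> m_gt0 leAm; set D := \sum_(i in A) g i.
have : 0 <= \sum_(i in A) (g i - m^-1 * D) ^+ 2.
  by apply: sumr_ge0 => i _; apply: sqr_ge0.
have -> : \sum_(i in A) (g i - m^-1 * D) ^+ 2
    = \sum_(i in A) g i ^+ 2 - 2 * m^-1 * D ^+ 2
      + #|A|%:R * (m^-1 * D) ^+ 2.
  rewrite [#|A|%:R * _]mulr_natl -sumr_const.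
  have -> : 2 * m^-1 * D ^+ 2 = \sum_(i in A) 2 * m^-1 * D * g i.
    by rewrite -mulr_sumr -/D; ring.
  by rewrite -sumrB -big_split; apply: eq_bigr => i _ /=; ring.
have : #|A|%:R * (m^-1 * D) ^+ 2 <= m * (m^-1 * D) ^+ 2.
  by apply: ler_wpM2r => //; apply: sqr_ge0.
have -> : m * (m^-1 * D) ^+ 2 = m^-1 * D ^+ 2.
  by field; apply: lt0r_neq0.
by lra.
Qed.

Section Cayley.

Variables (R : realType) (gT : finGroupType) (S : cayley_genset gT).
Implicit Types (f : gT -> R) (x s t : gT).

Lemma sum_cayley_adj (F : gT -> R) x :
  \sum_(y | cayley_adj S x y) F y = \sum_(s in genset S) F (x * s)%g.
Proof.
rewrite (reindex (mulg x)) /=; last first.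
  by exists (mulg x^-1) => y _; rewrite ?mulKg ?mulKVg.
apply: eq_bigl => s; apply/exists_inP/idP => [[t tS /eqP/mulgI ->] //|sS].
by exists s.
Qed.

Hypothesis S_class :
  {in genset S &, forall s t, (s ^ t)%g \in genset S}.

(** The translates tS and St coincide: ts = s't where s' is a conjugate of
    [s]. *)
Lemma sum_genset_comm (F : gT -> R) t : t \in genset S ->
  \sum_(s in genset S) F (t * s)%g = \sum_(s in genset S) F (s * t)%g.
Proof.
move=> tS; rewrite (reindex_inj (conjg_inj t)).
rewrite (eq_bigl (mem (genset S))) => [|s] /=.
  by apply: eq_bigr => s _; rewrite -conjgC.
apply/idP/idP => [stS|sS]; last exact: S_class.
by rewrite -(conjgK t s) S_class // genset_sym.
Qed.

(** With a = f(xst) - f(xt) and b = f(xs) - f(x), the exchange of factors makes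
    the term of Delta Gamma equal to (a^2 - b^2) / 2 and that of Gamma(f, Delta f)
    equal to b(a - b) / 2; the identity is then a^2 - b^2 = (a - b)^2 + 2b(a - b),
    summed over [s] and [t]. *)
Lemma gamma2_cayley f x :
  gamma2 (cayley_adj S) f x
  = 4^-1 * \sum_(s in genset S) \sum_(t in genset S)
      (f (x * s * t)%g - f (x * s)%g - f (x * t)%g + f x) ^+ 2.
Proof.
have -> : gamma2 (cayley_adj S) f x
    = 2^-1 * (2^-1 * \sum_(t in genset S) \sum_(s in genset S)
          ((f (x * s * t)%g - f (x * t)%g) ^+ 2 - (f (x * s)%g - f x) ^+ 2))
      - 2^-1 * \sum_(s in genset S) \sum_(t in genset S)
          (f (x * s)%g - f x)
          * (f (x * s * t)%g - f (x * s)%g - (f (x * t)%g - f x)).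
  rewrite /gamma2 gammaE {1}/laplacian !sum_cayley_adj; congr (_ * _ - _ * _).
    rewrite mulr_sumr; apply: eq_bigr => t tS.
    rewrite !gammaE !sum_cayley_adj -mulrBr sumrB; congr (_ * (_ - _)).
    under eq_bigr do rewrite -mulgA -expr2.
    rewrite (sum_genset_comm (fun u => (f (x * u)%g - f (x * t)%g) ^+ 2) tS).
    by apply: eq_bigr => s _; rewrite mulgA.
  apply: eq_bigr => s _.
  by rewrite /laplacian !sum_cayley_adj -sumrB mulr_sumr.
rewrite exchange_big /= !mulr_sumr -sumrB; apply: eq_bigr => s _.
rewrite !mulr_sumr -sumrB; apply: eq_bigr => t _.
by field.
Qed.

(** Only the diagonal terms s = t of [gamma2_cayley] are kept; there
    f(xst) = f(x). *)
Lemma CD0_involution_class (m : R) :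
  {in genset S, forall s, (s * s = 1)%g} -> 0 < m -> #|genset S|%:R <= m ->
  CD0 (cayley_adj S) m.
Proof.
move=> S_inv m_gt0 leSm f x.
rewrite gamma2_cayley /laplacian sum_cayley_adj.
apply: le_trans (sqr_sum_le _ m_gt0 leSm) _.
rewrite mulr_sumr; apply: ler_sum => s sS.
rewrite (bigD1 s) //= -mulgA S_inv // mulg1.
set r := \sum_(_ | _) _.
have : 0 <= r by apply: sumr_ge0 => t _; apply: sqr_ge0.
by nra.
Qed.

End Cayley.

Lemma transpositions_conj (n : nat) (s t : 'S_n) :
  s \in transpositions n -> (s ^ t)%g \in transpositions n.
Proof.
case/transpositionsP => i [j [ij ->]]; apply/transpositionsP.
by exists (t i), (t j); rewrite tpermJ (inj_eq perm_inj).
Qed.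

Lemma transpositions_invol (n : nat) (s : 'S_n) :
  s \in transpositions n -> (s * s = 1)%g.
Proof. by case/transpositionsP => i [j [_ ->]]; exact: tperm2. Qed.

Lemma card_transpositions_le (n : nat) :
  (#|transpositions n| <= n * n.-1)%N.
Proof.
apply: leq_trans (leq_imset_card _ _) _.
have -> : [set p : 'I_n * 'I_n | p.1 != p.2]
    = ~: [set (i, i) | i in [set: 'I_n]].
  apply/setP => -[i j]; rewrite !inE /=; congr (~~ _).
  by apply/eqP/imsetP => [->|[k _ [-> ->]]//]; exists j; rewrite ?inE.
rewrite cardsCs setCK card_imset => [|i j []//].
by rewrite card_prod cardsT card_ord; case: n => // n; rewrite mulnS addKn.
Qed.

Theorem corollary3p10 (R : realType) (n : nat) (hn : (2 <= n)%N) :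
  CD0 (cayley_adj (transposition_genset n)) (n%:R * (n%:R - 1) : R).
Proof.
have n_gt0 : (0 < n)%N by apply: leq_trans hn.
have -> : n%:R * (n%:R - 1) = (n * n.-1)%:R :> R.
  by rewrite natrM -subn1 natrB.
apply: CD0_involution_class => /=.
- by move=> s t sT _; exact: transpositions_conj.
- exact: transpositions_invol.
- by rewrite ltr0n muln_gt0 n_gt0 -subn1 subn_gt0.
- by rewrite ler_nat; exact: card_transpositions_le.
Qed.
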